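(* Let $n \in \mathbb{N}$, $E = \mathcal{S}(\mathbb{R}^n)$ and let $a > 0$ be a constant. Assume that $T : E \to E$ is a bijective operator satisfying $$| T(f \cdot g)(x) - (Tf \star Tg)(x) | \le a$$ for all $f, g \in E$ and all $x \in \mathbb{R}^n$. Then $$T(f \cdot g) = Tf \star Tg$$ for all $f, g \in E$.
   Context: $\mathcal{S}(\mathbb{R}^n)$ is the Schwartz space of rapidly decreasing smooth functions $f : \mathbb{R}^n \to \mathbb{C}$. $f \cdot g$ is the pointwise product and $(f \star g)(x) = \int_{\mathbb{R}^n} f(y)\, g(x-y)\, dy$ is the convolution. An operator $T$ is simply a map; it is not assumed to be linear or continuous. *)

(* Defs.v *)
From HB Require Import structures.
From mathcomp Require Import all_boot all_order all_algebra.
From mathcomp Require Import complex.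
From mathcomp Require Import all_classical all_reals all_analysis.
Set Implicit Arguments.
Unset Strict Implicit.
Unset Printing Implicit Defensive.
Import Order.TTheory GRing.Theory Num.Theory.
Import numFieldNormedType.Exports.
Local Open Scope classical_set_scope.
Local Open Scope ring_scope.
Local Open Scope complex_scope.

(* 'rV[R]_n carries the product sigma-algebra, which is the Borel one. *)
Section measurable_rV.
Variables (R : realType) (n : nat).

HB.instance Definition _ := @isMeasurable.Build default_measure_display
  'rV[R]_n (g_sigma_preimage (fun (i : 'I_n) (x : 'rV[R]_n) => x ord0 i))
  (@sigma_algebra0 _ _ _) (@sigma_algebraC _ _) (@sigma_algebra_bigcup _ _ _).

End measurable_rV.

Section lebesgue_rV.
Variable R : realType.

Lemma measurable_coord n (i : 'I_n) :
  measurable_fun setT (fun x : 'rV[R]_n => x ord0 i).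
Proof.
move=> _ Y mY; rewrite setTI; apply: sub_sigma_algebra => /=.
rewrite -bigcup_seq/=; exists i => /=; first by rewrite mem_index_enum.
by exists Y => //; rewrite setTI.
Qed.

Lemma measurable_fun_rV d (T : measurableType d) n (f : T -> 'rV[R]_n) :
  (forall i, measurable_fun setT (fun t => f t ord0 i)) ->
  measurable_fun setT f.
Proof.
move=> mf _ B; rewrite setTI.
suff H : g_sigma_preimage (fun (i : 'I_n) (x : 'rV[R]_n) => x ord0 i) `<=`
    [set B | measurable (f @^-1` B)] by exact: H.
apply: smallest_sub.
  split => /=.
  - by rewrite preimage_set0; exact: measurable0.
  - by move=> A mA; rewrite setTD preimage_setC; exact: measurableC.
  - by move=> F mF; rewrite preimage_bigcup; exact: bigcupT_measurable.
move=> A; rewrite -bigcup_seq/= => -[i _ [C mC <-]] /=.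
by rewrite setTI; have := mf i measurableT C mC; rewrite setTI.
Qed.

Definition cons_rV n (p : R * 'rV[R]_n) : 'rV[R]_n.+1 :=
  row_mx p.1%:M p.2.

Lemma cons_rV0 n (p : R * 'rV[R]_n) : cons_rV p ord0 ord0 = p.1.
Proof.
rewrite /cons_rV (_ : ord0 = lshift n ord0 :> 'I_(1 + n)); last exact: val_inj.
by rewrite (@row_mxEl _ 1 1 n) mxE mulr1n.
Qed.

Lemma cons_rVS n (p : R * 'rV[R]_n) i :
  cons_rV p ord0 (lift ord0 i) = p.2 ord0 i.
Proof.
rewrite /cons_rV (_ : lift ord0 i = rshift 1 i :> 'I_(1 + n)).
  by rewrite (@row_mxEr _ 1 1 n).
exact: val_inj.
Qed.

Lemma measurable_cons_rV n : measurable_fun setT (@cons_rV n).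
Proof.
apply: measurable_fun_rV => i; case: (unliftP ord0 i) => [j ->|->].
  under eq_fun do rewrite cons_rVS.
  exact: (measurableT_comp (measurable_coord j) measurable_snd).
under eq_fun do rewrite cons_rV0.
exact: measurable_fst.
Qed.

(* Lebesgue measure on R^n as the n-fold product of the one-dimensional one
   (lebesgue_rV_box), carried to row vectors by
   (t, y) |-> (t, y_1, ..., y_n); on R^0 it is the unit mass at the point. *)
Definition lebesgue_rVS n (m : {measure set 'rV[R]_n -> \bar R}) :
    {measure set 'rV[R]_n.+1 -> \bar R} :=
  @measure_function_pushforward__canonical__measure_function_Measure _ _ _ _ _
    ((@lebesgue_measure R) \x^ m)%E (@cons_rV n) (@measurable_cons_rV n).

Fixpoint lebesgue_rV n : {measure set 'rV[R]_n -> \bar R} :=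
  if n is k.+1 then lebesgue_rVS (lebesgue_rV k) else \d_(0 : 'rV[R]_0).

Lemma lebesgue_rV_box n (A : 'I_n -> set R) :
  (forall i, measurable (A i)) ->
  lebesgue_rV n [set x | forall i, A i (x ord0 i)] =
  (\prod_(i < n) @lebesgue_measure R (A i))%E.
Proof.
elim: n A => [|n IH] A mA.
  by rewrite big_ord0 /= diracE mem_set // => -[].
rewrite big_ord_recl -IH; last by move=> i; exact: mA.
rewrite -product_measure2E//.
  congr product_measure2; apply/seteqP; split => [[t y] /= H|[t y] /= [H1 H2] i].
  - split; first by have := H ord0; rewrite cons_rV0.
    by move=> i; have := H (lift ord0 i); rewrite cons_rVS.
  - by case: (unliftP ord0 i) => [j ->|->]; rewrite ?cons_rVS ?cons_rV0//; exact: H2.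
  exact: mA.
rewrite (_ : (fun x => _) = \bigcap_(i in [set: 'I_n])
    ((fun x : 'rV[R]_n => x ord0 i) @^-1` A (lift ord0 i))).
  apply: fin_bigcap_measurable => // i _.
  by rewrite -[X in measurable X]setTI; exact: measurable_coord.
by apply/seteqP; split => x /= H i; [move=> _|]; exact: H.
Qed.

End lebesgue_rV.

Section schwartz.
Variables (R : realType) (n : nat).
Implicit Types (u v : 'rV[R]_n -> R) (f g : 'rV[R]_n -> R[i]).

Definition partial (i : 'I_n) u : 'rV[R]_n -> R :=
  fun x => 'D_(delta_mx ord0 i) u x.

(* d/dx_(i_1) ... d/dx_(i_k) for s = [:: i_1; ...; i_k]; repetitions allowed *)
Definition partials (s : seq 'I_n) u : 'rV[R]_n -> R := foldr partial u s.

Definition smooth u : Prop := forall s : seq 'I_n,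
  continuous (partials s u) /\
  forall (i : 'I_n) (x : 'rV[R]_n), derivable (partials s u) x (delta_mx ord0 i).

Definition cpartials (s : seq 'I_n) f : 'rV[R]_n -> R[i] :=
  fun x => partials s (fun y => complex.Re (f y)) x +i*
           partials s (fun y => complex.Im (f y)) x.

Definition csmooth f : Prop :=
  smooth (fun x => complex.Re (f x)) /\ smooth (fun x => complex.Im (f x)).

Definition monomial (alpha : 'I_n -> nat) (x : 'rV[R]_n) : R :=
  \prod_(i < n) x ord0 i ^+ alpha i.

(* `|_| on R[i] is the modulus, as an element of R[i]; all iterated partial
   derivatives are covered, so in particular those of multi-index form. *)
Definition rapidly_decreasing f : Prop :=
  forall (alpha : 'I_n -> nat) (s : seq 'I_n), exists M : R,
    forall x : 'rV[R]_n, `|(monomial alpha x)%:C * cpartials s f x| <= M%:C.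

Definition is_schwartz f : Prop := csmooth f /\ rapidly_decreasing f.

Record schwartz : Type := Schwartz {
  schwartz_fun :> 'rV[R]_n -> R[i];
  schwartzP : is_schwartz schwartz_fun }.


Lemma normc_le_real (z : R[i]) (M : R) :
  `|z| <= M%:C -> `|complex.Re z| <= M /\ `|complex.Im z| <= M.
Proof.
move=> zM; have n0 (t : R) : `|t| = Num.sqrt (t ^+ 2) by rewrite sqrtr_sqr.
move: zM; rewrite normc_def lecR => zM; rewrite !n0.
by split; apply: le_trans zM; rewrite ler_sqrt ?addr_ge0 ?sqr_ge0//
  ?lerDl ?lerDr ?sqr_ge0.
Qed.

Lemma normc_le_sum (z : R[i]) :
  `|z| <= (`|complex.Re z| + `|complex.Im z|)%:C.
Proof.
rewrite normc_def lecR -[leRHS]ger0_norm ?addr_ge0// -sqrtr_sqr.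
rewrite ler_sqrt ?sqr_ge0// sqrrD !real_normK ?num_real// addrAC lerDl.
by rewrite mulrn_wge0// mulr_ge0.
Qed.

Let derivs u (s : seq 'I_n) := continuous (partials s u) /\
  forall i x, derivable (partials s u) x (delta_mx ord0 i).

Let decays u (s : seq 'I_n) := forall alpha : 'I_n -> nat, exists M : R,
  forall x, `|monomial alpha x * partials s u x| <= M.

Let tame u (s : seq 'I_n) := derivs u s /\ decays u s.

Lemma is_schwartz_components f : is_schwartz f <->
  (forall s, tame (fun x => complex.Re (f x)) s) /\
  (forall s, tame (fun x => complex.Im (f x)) s).
Proof.
have mulE (a : R) (z : R[i]) : a%:C * z = (a * complex.Re z) +i* (a * complex.Im z).
  by case: z => b c; rewrite /= /real_complex_def; apply/eqP;
     rewrite eq_complex /= !mul0r subr0 addr0 !eqxx.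
split=> [[[sR sI] dec]|[tR tI]].
  split=> s; (split; first by [exact: sR|exact: sI]) => a;
    have [M HM] := dec a s; exists M => x; have := HM x;
    by rewrite mulE => /normc_le_real[].
split; first by split => s; [have [] := tR s|have [] := tI s].
move=> a s; have [_ /(_ a) [M HM]] := tR s; have [_ /(_ a) [N HN]] := tI s.
exists (M + N) => x; rewrite mulE; apply: le_trans (normc_le_sum _) _.
by rewrite lecR /= lerD.
Qed.

Lemma partials_rcons s i u : partials (rcons s i) u = partials s (partial i u).
Proof. by rewrite /partials foldr_rcons. Qed.

Let tame_partial i u : (forall s, tame u s) -> forall s, tame (partial i u) s.
Proof. by move=> tu s; rewrite /tame /derivs /decays -partials_rcons; exact: tu. Qed.

Let partialsD k u v :
  (forall s, (size s < k)%N -> derivs u s) ->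
  (forall s, (size s < k)%N -> derivs v s) ->
  forall s, (size s <= k)%N -> partials s (u + v) = partials s u + partials s v.
Proof.
move=> du dv; elim=> [//|i s IH] sk /=.
rewrite [LHS]/= IH; last exact: ltnW.
by apply/funext => x; rewrite /partial deriveD//;
  [exact: (du s sk).2|exact: (dv s sk).2].
Qed.

Let tameD k u v :
  (forall s, (size s <= k)%N -> tame u s) ->
  (forall s, (size s <= k)%N -> tame v s) ->
  forall s, (size s <= k)%N -> tame (u + v) s.
Proof.
move=> tu tv s sk.
have E : partials s (u + v) = partials s u + partials s v.
  by apply: (@partialsD k) => // t tk; [apply: (tu t _).1|apply: (tv t _).1];
    exact: ltnW.
have [[cu du] eu] := tu s sk; have [[cv dv] ev] := tv s sk.
rewrite /tame /derivs /decays E; split; [split|] => //.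
- by move=> x; apply: continuousD; [exact: cu|exact: cv].
- by move=> i x; apply: derivableD.
- move=> a; have [M HM] := eu a; have [N HN] := ev a; exists (M + N) => x.
  by rewrite mulrDr (le_trans (ler_normD _ _))// lerD.
Qed.

Let partialsN u : (forall s, tame u s) ->
  forall s, partials s (- u) = - partials s u.
Proof.
move=> tu; elim=> [//|i s IH] /=; rewrite IH.
by apply/funext => x; rewrite /partial deriveN//; exact: (tu s).1.2.
Qed.

Let tameN u : (forall s, tame u s) -> forall s, tame (- u) s.
Proof.
move=> tu s; have [[cu du] eu] := tu s.
rewrite /tame /derivs /decays partialsN//; split; [split|].
- by move=> x; apply: continuousN; exact: cu.
- by move=> i x; apply: derivableN.
- by move=> a; have [M HM] := eu a; exists M => x; rewrite mulrN normrN.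
Qed.

Let tameM k u v : (forall s, tame u s) -> (forall s, tame v s) ->
  forall s, (size s <= k)%N -> tame (u * v) s.
Proof.
elim: k u v => [|k IH] u v tu tv s sk; last first.
  case/lastP: s sk => [_|s i]; first exact: IH.
  rewrite size_rcons ltnS => sk.
  rewrite /tame /derivs /decays partials_rcons.
  suff -> : partial i (u * v) = u * partial i v + partial i u * v.
    apply: (@tameD k) => // t tk; apply: IH => //; exact: tame_partial.
  apply/funext => x; rewrite /partial deriveM; last 2 first.
  - exact: (tu [::]).1.2.
  - exact: (tv [::]).1.2.
  by congr (_ + _); rewrite mulrC.
have -> : s = [::] by case: s sk.
have [[cu du] eu] := tu [::]; have [[cv dv] ev] := tv [::].
split; first split.
- by move=> x; apply: continuousM; [exact: cu|exact: cv].
- by move=> i x; apply: derivableM.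
- move=> a; have [M HM] := eu a; have [N HN] := ev (fun=> 0%N).
  exists (M * N) => x; rewrite mulrA normrM.
  apply: ler_pM => //; last by have := HN x; rewrite /monomial big1 ?mul1r.
Qed.

Let ReM (z w : R[i]) : complex.Re (z * w) =
  complex.Re z * complex.Re w - complex.Im z * complex.Im w.
Proof. by case: z w => [? ?] [? ?]. Qed.

Let ImM (z w : R[i]) : complex.Im (z * w) =
  complex.Re z * complex.Im w + complex.Im z * complex.Re w.
Proof. by case: z w => [? ?] [? ?]. Qed.

Lemma is_schwartzM f g : is_schwartz f -> is_schwartz g ->
  is_schwartz (fun x => f x * g x).
Proof.
move=> /is_schwartz_components[fR fI] /is_schwartz_components[gR gI].
apply/is_schwartz_components; split=> s.
- rewrite (_ : (fun x => _) =
      (fun x => complex.Re (f x)) * (fun x => complex.Re (g x))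
    - (fun x => complex.Im (f x)) * (fun x => complex.Im (g x))); last first.
    by apply/funext => x; rewrite ReM !fctE.
  apply: (@tameD (size s)) => // t tk; first exact: (@tameM (size t)).
  by apply: tameN => r; exact: (@tameM (size r)).
- rewrite (_ : (fun x => _) =
      (fun x => complex.Re (f x)) * (fun x => complex.Im (g x))
    + (fun x => complex.Im (f x)) * (fun x => complex.Re (g x))); last first.
    by apply/funext => x; rewrite ImM !fctE.
  by apply: (@tameD (size s)) => // t tk; exact: (@tameM (size t)).
Qed.

Definition schwartz_mul (f g : schwartz) : schwartz :=
  Schwartz (is_schwartzM (schwartzP f) (schwartzP g)).

Lemma schwartz_inj (f g : schwartz) : (forall x, f x = g x) -> f = g.
Proof.
case: f g => [f fP] [g gP] /= /funext fg; subst g.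
by rewrite (Prop_irrelevance fP gP).
Qed.

(* On integrable f this is the integral of f; each Rintegral is 0 by
   convention where the real integral diverges, which does not happen for
   the convolution of two Schwartz functions. *)
Definition cintegral f : R[i] :=
  (\int[lebesgue_rV R n]_y complex.Re (f y))%R +i*
  (\int[lebesgue_rV R n]_y complex.Im (f y))%R.

(* Stated on plain functions, so that using it does not presuppose that the
   Schwartz space is stable under convolution. *)
Definition convolution f g : 'rV[R]_n -> R[i] :=
  fun x => cintegral (fun y => f y * g (x - y)).

End schwartz.

(* Main.v *)
(* Let D(f, g) = T(fg) - Tf * Tg (convolution), bounded by a. Associativity of
   both products gives
     D(f, g) * Th - Tf * D(g, h) = D(f, gh) - D(fg, h),
   so that D(f, g) * Th is bounded at each point independently of h. As T is
   onto, Th can be any Gaussian c exp(-k|y|^2); letting c go to infinity, the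
   integrals of D(f, g)(y) exp(-k|x - y|^2) vanish for all k > 0, and Laplace's
   method (k -> oo) gives D(f, g)(x) = 0, because D(f, g) is continuous. *)

Require Import Defs.
From HB Require Import structures.
From mathcomp Require Import all_boot all_order all_algebra.
From mathcomp Require Import complex.
From mathcomp Require Import all_classical all_reals all_analysis.
From mathcomp Require Import measurable_realfun.
From mathcomp Require Import ring lra.
Import Order.TTheory GRing.Theory Num.Theory.
Import numFieldNormedType.Exports.
Set Implicit Arguments.
Unset Strict Implicit.
Unset Printing Implicit Defensive.
Local Open Scope classical_set_scope.
Local Open Scope ring_scope.
Local Open Scope complex_scope.

(** * Lebesgue measure on row vectors *)

Section lebesgue_rV.
Context {R : realType}.
Local Notation mu := (@lebesgue_rV R).

(** The convolution of two Schwartz functions is never shown to be Schwartz, so the defect is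
    handled merely as a continuous bounded function. All estimates therefore run through two
    classes: functions dominated by the integrable weight given by the product of the
    [1 / (1 + x_i ^ 2)], and bounded functions. Schwartz functions lie in the first, and a
    convolution makes sense as soon as one factor does. Peetre's inequality keeps the first class
    stable under [y |-> x - y] at fixed [x], which justifies Fubini in the associativity law. The
    bound independent of [h] is possible because [h] enters the three remaining terms only through
    defects, each at most [a] whatever [h] is, while [Tf] is integrable. As [T] need not be
    homogeneous, a large amplitude cannot be obtained by scaling [h]: every multiple of a Gaussian
    needs its own preimage. *)

Lemma measurable_box n (A : 'I_n -> set R) : (forall i, measurable (A i)) ->
  measurable [set x : 'rV[R]_n | forall i, A i (x ord0 i)].
Proof.
move=> mA; rewrite (_ : mkset _ = \bigcap_(i in [set: 'I_n])
    ((fun x : 'rV[R]_n => x ord0 i) @^-1` A i)).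
  apply: fin_bigcap_measurable => // i _.
  by rewrite -[X in measurable X]setTI; exact: measurable_coord.
by apply/seteqP; split => x /= H i; [move=> _|]; exact: H.
Qed.

(** The sigma-algebra is generated by the coordinates, so an open set has to be exhausted by
    countably many boxes: those with rational centre and half-width [1 / (k + 1)] that it
    contains. *)
Lemma open_measurable_rV n (U : set 'rV[R]_n) : open U -> measurable U.
Proof.
move=> oU.
pose B (p : 'rV[rat]_n * nat) : set 'rV[R]_n :=
  [set x | forall i, `|ratr (p.1 ord0 i) - x ord0 i| < p.2.+1%:R^-1].
have -> : U = \bigcup_(p in [set p | B p `<=` U]) B p.
  apply/seteqP; split => [x Ux|x [p /= pU Bp]]; last exact: pU.
  have [e /= e0 eU] : nbhs_ball x U by apply/nbhs_ballP; exact: open_nbhs_nbhs.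
  (* Half of [e], because a point [y] of the box is reached from [x] through the rational centre, at
     a cost below [1 / (k + 1)] each way. *)
  have [k ke] : exists k : nat, k.+1%:R^-1 < e / 2.
    have e20 : 0 < e / 2 by rewrite divr_gt0.
    exists (Num.trunc (e / 2)^-1); rewrite invf_plt ?posrE//.
    exact: truncnS_gt.
  have k0 : 0 < k.+1%:R^-1 :> R by rewrite invr_gt0.
  have rx (i : 'I_n) : exists q : rat, `|ratr q - x ord0 i| < k.+1%:R^-1.
    have [||p [/= hp [q _ qE]]] := @dense_rat R (ball (x ord0 i) k.+1%:R^-1).
    - by exists (x ord0 i); exact: ballxx.
    - exact: ball_open.
    - by exists q; rewrite qE distrC.
  have [q qx] := choice rx.
  exists (\row_i q i, k) => /=; last by move=> i; rewrite /= mxE.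
  move=> y By; apply: eU; split => // i j; rewrite ord1.
  have := By j; have := qx j; rewrite /= mxE => h1 h2.
  rewrite /ball /= -(subrK (ratr (q j)) (x _ _)) -addrA.
  rewrite (le_lt_trans (ler_normD _ _))// (splitr e) distrC ltrD//.
    exact: lt_trans ke.
  exact: lt_trans ke.
rewrite bigcup_mkcond; apply: countable_bigcupT_measurable => // p.
case: ifPn => // _.
apply: (@measurable_box n (fun i => ball (ratr (p.1 ord0 i) : R) p.2.+1%:R^-1)).
by move=> i; apply: open_measurable; exact: ball_open.
Qed.

Lemma continuous_measurable_rV n (u : 'rV[R]_n -> R) :
  continuous u -> measurable_fun setT u.
Proof.
move=> /continuousP cu; apply: (measurability _ (RGenOInfty.measurableE R)).
move=> _ [_ [x ->] <-]; rewrite setTI; apply: open_measurable_rV.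
exact/cu/interval_open.
Qed.

Lemma lebesgue_rV_sigma_finite n : sigma_finite setT (mu n).
Proof.
pose F (k : nat) : set 'rV[R]_n :=
  [set x | forall i, `](- k%:R)%R, k%:R]%classic (x ord0 i)].
exists F.
  apply/esym/seteqP; split => // x _ /=.
  exists (\max_(i < n) (Num.trunc `|x ord0 i|).+1) => // i /=.
  have h : `|x ord0 i| < (\max_(i < n) (Num.trunc `|x ord0 i|).+1)%:R.
    apply: lt_le_trans (truncnS_gt _) _.
    by rewrite ler_nat; exact: (leq_bigmax i).
  rewrite in_itv/=; move: h; rewrite ltr_norml => /andP[-> /ltW ->] //.
move=> k; split.
  exact: (@measurable_box n (fun=> `](- k%:R)%R, k%:R]%classic)).
rewrite (@lebesgue_rV_box R n (fun=> `](- k%:R)%R, k%:R]%classic)) //.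
rewrite ltey_eq; apply/orP; left; elim/big_ind : _ => //.
- by move=> x y xfin yfin; rewrite fin_numM.
- by move=> i _; rewrite lebesgue_measure_itv/=; case: ifP.
Qed.

(** The same measure bundled with its sigma-finiteness, the form in which the Fubini and Tonelli
    theorems take it. *)
Definition slebesgue_rV n : {sigma_finite_measure set 'rV[R]_n -> \bar R} :=
  HB.pack_for (SigmaFiniteMeasure.type _ R) (Measure.sort (mu n))
    (isSFinite.Build _ _ _ (mu n)
      (sfinite_measure_sigma_finite (lebesgue_rV_sigma_finite n)))
    (isSigmaFinite.Build _ _ _ (mu n) (lebesgue_rV_sigma_finite n)).

Local Open Scope ereal_scope.

Lemma ge0_integral_rVS n (f : 'rV[R]_n.+1 -> \bar R) :
  measurable_fun setT f -> (forall x, 0 <= f x) ->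
  \int[mu n.+1]_x f x =
  \int[lebesgue_measure]_t \int[mu n]_y f (cons_rV (t, y)).
Proof.
move=> mf f0.
rewrite ge0_integral_pushforward//; last exact: measurable_cons_rV.
rewrite preimage_setT.
(* [lebesgue_rV] is built on the product [\x^], Tonelli is stated for [\x]; the two agree on
   rectangles, hence everywhere by uniqueness of sigma-finite product measures. *)
transitivity (\int[lebesgue_measure \x (slebesgue_rV n)]_x (f \o @cons_rV R n) x).
  apply: eq_measure_integral => A mA _; apply/esym.
  by apply: (@product_measure_unique _ _ _ _ R lebesgue_measure (slebesgue_rV n)
    (lebesgue_measure \x^ (mu n))) => //= B C mB mC;
    rewrite product_measure2E.
rewrite fubini_tonelli1//; last by move=> x; exact: f0.
exact: (measurableT_comp mf (@measurable_cons_rV R n)).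
Qed.

Lemma lebesgue_measure_shift (c : R) (A : set R) : measurable A ->
  pushforward lebesgue_measure (fun t : R => (t + c)%R : measurableTypeR R) A =
  lebesgue_measure A.
Proof.
move=> mA; apply/esym.
have mc : measurable_fun setT (fun t : R => (t + c)%R : measurableTypeR R).
  exact: measurable_funD.
pose m := @measure_function_pushforward__canonical__measure_function_Measure
  _ _ _ _ _ (@lebesgue_measure R) _ mc.
apply: (@lebesgue_measure_unique R m) => //= _ [[a b]] _ <-.
rewrite /pushforward (_ : _ @^-1` _ = `](a - c)%R, (b - c)%R]%classic).
  rewrite !lebesgue_measure_itv/= !lte_fin ltrD2r; case: ifPn => // _.
  by rewrite -!EFinB opprB addrA subrK.
by apply/seteqP; split => x /=; rewrite !in_itv/= ltrBlDr lerBrDr.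
Qed.

Lemma ge0_integral_shift (c : R) (f : R -> \bar R) :
  measurable_fun setT f -> (forall r, 0 <= f r) ->
  \int[lebesgue_measure]_t f (t + c)%R = \int[lebesgue_measure]_t f t.
Proof.
move=> mf f0.
have mc : measurable_fun setT (fun t : R => (t + c)%R : measurableTypeR R).
  exact: measurable_funD.
transitivity (\int[pushforward lebesgue_measure
    (fun t : R => (t + c)%R : measurableTypeR R)]_t f t).
  by rewrite ge0_integral_pushforward.
by apply: eq_measure_integral => A mA _; exact: lebesgue_measure_shift.
Qed.

Lemma measurable_add_rV n (c : 'rV[R]_n) :
  measurable_fun setT (fun x : 'rV[R]_n => (x + c)%R).
Proof.
apply: measurable_fun_rV => i; under eq_fun do rewrite mxE.
by apply: measurable_funD => //; exact: measurable_coord.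
Qed.

(** Induction on the dimension: Tonelli splits off the first coordinate, the induction hypothesis
    absorbs the tail [c'] of the shift in the inner integral, and one-dimensional invariance absorbs
    its head in the outer one. *)
Lemma ge0_integral_rV_shift n (c : 'rV[R]_n) (f : 'rV[R]_n -> \bar R) :
  measurable_fun setT f -> (forall x, 0 <= f x) ->
  \int[mu n]_x f (x + c)%R = \int[mu n]_x f x.
Proof.
elim: n c f => [|n IH] c f mf f0.
  by apply: eq_integral => x _; congr f; apply/rowP => -[].
have fc0 (x : 'rV[R]_n.+1) : 0 <= f (x + c)%R by [].
have mfc : measurable_fun setT (fun x : 'rV[R]_n.+1 => f (x + c)%R).
  exact: (measurableT_comp mf (measurable_add_rV c)).
rewrite !ge0_integral_rVS //.
pose c' : 'rV[R]_n := \row_i c ord0 (lift ord0 i).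
have E t y : (cons_rV (t, y) + c = cons_rV (t + c ord0 ord0, y + c'))%R.
  apply/rowP => i; rewrite mxE; case: (unliftP ord0 i) => [j ->|->].
    by rewrite !cons_rVS !mxE.
  by rewrite !cons_rV0.
have mft t : measurable_fun setT (fun y : 'rV[R]_n => f (cons_rV (t, y))).
  apply: (measurableT_comp mf).
  exact: (measurableT_comp (@measurable_cons_rV R n) (measurable_pair1 _)).
pose F (t : R) := \int[mu n]_y f (cons_rV (t, y)).
transitivity (\int[lebesgue_measure]_t F (t + c ord0 ord0)%R).
  apply: eq_integral => t _.
  rewrite /F -(IH c' (fun y => f (cons_rV ((t + c ord0 ord0)%R, y))))//.
  by apply: eq_integral => y _; congr f; exact: E.
apply: (@ge0_integral_shift _ F) => [|t]; last exact: integral_ge0.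
apply: (@measurable_fun_fubini_tonelli_F _ _ _ _ _ (slebesgue_rV n)
    (f \o @cons_rV R n)) => [|x]; last exact: f0.
exact: (measurableT_comp mf (@measurable_cons_rV R n)).
Qed.

End lebesgue_rV.

(** * An integrable weight *)

Section weight.
Context {R : realType}.
Local Notation mu := (@lebesgue_rV R).

Definition weight n (x : 'rV[R]_n) : R := \prod_(i < n) (oneDsqr (x ord0 i))^-1.

Lemma weight_gt0 n (x : 'rV[R]_n) : 0 < weight x.
Proof. by apply: prodr_gt0 => i _; rewrite invr_gt0 (lt_le_trans ltr01). Qed.

Lemma weight_ge0 n (x : 'rV[R]_n) : 0 <= weight x.
Proof. exact/ltW/weight_gt0. Qed.

Lemma weight_le1 n (x : 'rV[R]_n) : weight x <= 1.
Proof.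
apply: prodr_ile1 => i _; apply/andP; split; last exact: oneDsqrV_le1.
by rewrite invr_ge0 (le_trans ler01).
Qed.

Lemma measurable_weight n : measurable_fun setT (@weight n).
Proof.
rewrite /weight.
apply: measurable_prod => i _.
apply: (measurableT_comp (continuous_measurable_fun (@continuous_oneDsqrV R))).
exact: measurable_coord.
Qed.

Lemma weight_cons n (t : R) (y : 'rV[R]_n) :
  weight (cons_rV (t, y)) = (oneDsqr t)^-1 * weight y.
Proof.
rewrite /weight big_ord_recl cons_rV0; congr (_ * _).
by apply: eq_bigr => i _; rewrite cons_rVS.
Qed.

(* Peetre's inequality. *)
Lemma weight_sub n (x y : 'rV[R]_n) :
  weight (x - y) <= 2 ^+ n / weight x * weight y.
Proof.
have -> : 2 ^+ n = \prod_(i < n) 2 :> R by rewrite prodr_const card_ord.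
rewrite /weight -prodfV -!big_split /=.
apply: ler_prod => i _; rewrite !mxE invrK /oneDsqr.
set a := x _ _; set b := y _ _.
have pos (t : R) : 0 < 1 + t ^+ 2 by rewrite ltr_pwDl// sqr_ge0.
rewrite invr_ge0 ltW//= ler_pdivlMr// mulrC ler_pdivrMr// -subr_ge0.
(* Coordinatewise the claim is [1 + b ^ 2 <= 2 (1 + a ^ 2) (1 + (a - b) ^ 2)], whence one factor 2
   per dimension; its slack is this sum of squares. *)
rewrite (_ : _ - _ = 1 + (2 * a - b) ^+ 2 + 2 * (a * (a - b)) ^+ 2); last by ring.
by apply: addr_ge0; [apply: addr_ge0|apply: mulr_ge0] => //; exact: sqr_ge0.
Qed.

Local Open Scope ereal_scope.

Lemma integral_oneDsqrV_lty :
  \int[lebesgue_measure]_(t in setT) ((@oneDsqr R t)^-1)%:E < +oo.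
Proof.
rewrite (@ge0_symfun_integralT R (fun t => (oneDsqr t)^-1%R)).
- by rewrite -set_itvcy integral0y_oneDsqr -EFinM ltry.
- by move=> x; rewrite invr_ge0 (le_trans ler01).
- exact: continuous_oneDsqrV.
- by move=> x; rewrite /= /oneDsqr sqrrN.
Qed.

Lemma integrable_weight n : (mu n).-integrable setT (EFin \o @weight n).
Proof.
apply/integrableP; split.
  by apply/measurable_EFinP; exact: measurable_weight.
under eq_integral do rewrite /= ger0_norm ?weight_ge0//.
elim: n => [|n IH].
  under eq_integral do rewrite /weight big_ord0.
  by rewrite integral_cst//= diracE mem_set// mule1 ltry.
have mw k : measurable_fun setT (fun x : 'rV[R]_k => (weight x)%:E).
  by apply/measurable_EFinP; exact: measurable_weight.
have o0 (t : R) : (0 <= (oneDsqr t)^-1)%R by rewrite invr_ge0 (le_trans ler01).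
have w0 k (x : 'rV[R]_k) : 0 <= (weight x)%:E by rewrite lee_fin weight_ge0.
rewrite ge0_integral_rVS//.
rewrite (_ : (fun t => _) = (fun t => (oneDsqr t)^-1%:E *
    \int[mu n]_y (weight y)%:E)); last first.
  apply/funext => t; rewrite -ge0_integralZl//; last exact: mw.
  by apply: eq_integral => y _; rewrite weight_cons EFinM.
rewrite ge0_integralZr//.
- rewrite lte_mul_pinfty//.
  + by apply: integral_ge0 => t _; rewrite lee_fin.
  + rewrite ge0_fin_numE ?integral_oneDsqrV_lty//.
    by apply: integral_ge0 => t _; rewrite lee_fin.
- apply/measurable_EFinP; apply: continuous_measurable_fun.
  exact: continuous_oneDsqrV.
- exact: integral_ge0.
Qed.

Lemma integral_rV_shift n (c : 'rV[R]_n) (f : 'rV[R]_n -> \bar R) :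
  measurable_fun setT f ->
  \int[mu n]_x f (x + c)%R = \int[mu n]_x f x.
Proof.
move=> mf; rewrite [LHS]integralE [RHS]integralE; congr (_ - _).
- rewrite -[RHS](ge0_integral_rV_shift c).
  + by apply: eq_integral => x _; rewrite !funeposE.
  + exact: measurable_funepos.
  + by move=> x; exact: funepos_ge0.
- rewrite -[RHS](ge0_integral_rV_shift c).
  + by apply: eq_integral => x _; rewrite !funenegE.
  + exact: measurable_funeneg.
  + by move=> x; exact: funeneg_ge0.
Qed.

End weight.

(** * Complex integrals *)

Section cintegral.
Context {R : realType}.
Local Notation mu := (@lebesgue_rV R).
Local Notation Re := complex.Re.
Local Notation Im := complex.Im.

(** A real-valued stand-in for the modulus, which lives in [R[i]]. It is submultiplicative and
    dominates both components, so bounds pass directly to the two real integrals that make up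
    [cintegral]. *)
Definition l1norm (z : R[i]) : R := `|Re z| + `|Im z|.

Lemma Re_le_l1norm (z : R[i]) : `|Re z| <= l1norm z.
Proof. by rewrite lerDl. Qed.

Lemma Im_le_l1norm (z : R[i]) : `|Im z| <= l1norm z.
Proof. by rewrite lerDr. Qed.

Lemma l1norm_ge0 (z : R[i]) : 0 <= l1norm z.
Proof. by rewrite addr_ge0. Qed.

Lemma ReM (z w : R[i]) : Re (z * w) = Re z * Re w - Im z * Im w.
Proof. by case: z w => [? ?] [? ?]. Qed.

Lemma ImM (z w : R[i]) : Im (z * w) = Re z * Im w + Im z * Re w.
Proof. by case: z w => [? ?] [? ?]. Qed.

Lemma ReB (z w : R[i]) : Re (z - w) = Re z - Re w.
Proof. by case: z w => [? ?] [? ?]. Qed.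

Lemma ImB (z w : R[i]) : Im (z - w) = Im z - Im w.
Proof. by case: z w => [? ?] [? ?]. Qed.

Lemma l1normM (z w : R[i]) : l1norm (z * w) <= l1norm z * l1norm w.
Proof.
rewrite /l1norm ReM ImM mulrDl !mulrDr -!normrM.
apply: le_trans (lerD (ler_normB _ _) (ler_normD _ _)) _.
by lra.
Qed.

Lemma l1normB (z w : R[i]) : l1norm (z - w) <= l1norm z + l1norm w.
Proof.
rewrite /l1norm ReB ImB (le_trans (lerD (ler_normB _ _) (ler_normB _ _)))//.
by lra.
Qed.

Definition cmeasurable d (T : measurableType d) (f : T -> R[i]) :=
  measurable_fun setT (fun x => Re (f x)) /\
  measurable_fun setT (fun x => Im (f x)).

Lemma cmeasurableM d (T : measurableType d) (f g : T -> R[i]) :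
  cmeasurable f -> cmeasurable g -> cmeasurable (fun x => f x * g x).
Proof.
move=> [fR fI] [gR gI]; split.
  under eq_fun do rewrite ReM.
  by apply: measurable_funB; exact: measurable_funM.
under eq_fun do rewrite ImM.
by apply: measurable_funD; exact: measurable_funM.
Qed.

Lemma cmeasurableB d (T : measurableType d) (f g : T -> R[i]) :
  cmeasurable f -> cmeasurable g -> cmeasurable (fun x => f x - g x).
Proof.
move=> [fR fI] [gR gI]; split.
  by under eq_fun do rewrite ReB; exact: measurable_funB.
by under eq_fun do rewrite ImB; exact: measurable_funB.
Qed.

Lemma cmeasurable_cst d (T : measurableType d) (z : R[i]) :
  cmeasurable (fun _ : T => z).
Proof. by split. Qed.

Lemma cmeasurable_comp d d' (T : measurableType d) (T' : measurableType d')
    (f : T' -> R[i]) (g : T -> T') :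
  cmeasurable f -> measurable_fun setT g -> cmeasurable (fun x => f (g x)).
Proof.
move=> [fR fI] mg; split.
  exact: (measurableT_comp fR mg).
exact: (measurableT_comp fI mg).
Qed.

Lemma measurable_sub_rV d (T : measurableType d) n (f g : T -> 'rV[R]_n) :
  measurable_fun setT f -> measurable_fun setT g ->
  measurable_fun setT (fun t => f t - g t).
Proof.
move=> mf mg; apply: measurable_fun_rV => i; under eq_fun do rewrite !mxE.
apply: measurable_funB.
  exact: (measurableT_comp (measurable_coord i) mf).
exact: (measurableT_comp (measurable_coord i) mg).
Qed.

Section fixed_dimension.
Variable n : nat.
Implicit Types f g : 'rV[R]_n -> R[i].

Lemma integrable_dominated (u : 'rV[R]_n -> R) M :
  measurable_fun setT u -> (forall x, `|u x| <= M * weight x) ->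
  (mu n).-integrable setT (EFin \o u).
Proof.
move=> mf fM.
have iM := integrableZl measurableT M (@integrable_weight R n).
apply: (le_integrable measurableT _ _ iM); first exact/measurable_EFinP.
by move=> x _ /=; rewrite lee_fin (le_trans (fM x))// ler_norm.
Qed.

Lemma Rintegral_swap (u : 'rV[R]_n * 'rV[R]_n -> R) M :
  measurable_fun setT u ->
  (forall y z, `|u (y, z)| <= M * (weight y * weight z)) ->
  (\int[mu n]_y (\int[mu n]_z u (y, z)) = \int[mu n]_z (\int[mu n]_y u (y, z)))%R.
Proof.
move=> mf fM.
have iy y : (mu n).-integrable setT (EFin \o (fun z => u (y, z))).
  apply: (@integrable_dominated _ (M * weight y)) => [|z].
    exact: (measurableT_comp mf (measurable_pair1 _)).
  by rewrite -mulrA.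
have iz z : (mu n).-integrable setT (EFin \o (fun y => u (y, z))).
  apply: (@integrable_dominated _ (M * weight z)) => [|y].
    exact: (measurableT_comp mf (measurable_pair2 _)).
  by rewrite -mulrA [weight z * _]mulrC.
have ifin (v : 'rV[R]_n -> R) : (mu n).-integrable setT (EFin \o v) ->
    (\int[mu n]_x v x)%:E = (\int[mu n]_x (v x)%:E)%E.
  by move=> iv; rewrite fineK//; exact: integrable_fin_num.
congr fine.
under eq_integral do rewrite ifin//.
under [RHS]eq_integral do rewrite ifin//.
apply: (@Fubini _ _ _ _ R (slebesgue_rV n) (slebesgue_rV n) (EFin \o u)).
(* Integrability on the product reduces to a finite iterated integral of the absolute value. The
   inner integral is at most a constant times [weight y]; [|M|] replaces [M], whose sign is
   unknown. *)
apply/integrable12ltyP; first exact/measurable_EFinP.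
have iw := @integrable_weight R n.
have := integrableZl measurableT (`|M| * \int[mu n]_z weight z) iw.
move/integrableP => [_]; apply: le_lt_trans; apply: ge0_le_integral => //.
- by move=> y _; exact: integral_ge0.
- apply: (@measurable_fun_fubini_tonelli_F _ _ _ _ _ (slebesgue_rV n)
    (fun x => `|(u x)%:E|%E)) => //.
  by apply: measurableT_comp => //; exact/measurable_EFinP.
- apply: measurableT_comp => //; apply/measurable_EFinP.
  by apply: measurable_funM => //; exact: measurable_weight.
move=> y _.
apply: (@le_trans _ _ (\int[mu n]_z ((`|M| * weight y)%:E * (weight z)%:E))%E).
  apply: ge0_le_integral => //.
  - apply: measurableT_comp => //; apply/measurable_EFinP.
    exact: (measurableT_comp mf (measurable_pair1 _)).
  - apply/measurable_EFinP; apply: measurable_funM => //.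
    exact: measurable_weight.
  - move=> z _; rewrite -EFinM /= lee_fin (le_trans (fM y z))// mulrA.
    by rewrite !ler_wpM2r ?weight_ge0// ler_norm.
rewrite integralZl// -ifin// -EFinM /= lee_fin mulrAC.
exact: ler_norm.
Qed.

Definition cintegrable f :=
  (mu n).-integrable setT (fun x => (Re (f x))%:E) /\
  (mu n).-integrable setT (fun x => (Im (f x))%:E).

Lemma cintegrable_dominated f M :
  cmeasurable f -> (forall x, l1norm (f x) <= M * weight x) -> cintegrable f.
Proof.
move=> [mR mI] fM; split.
  apply: (@integrable_dominated (fun x => Re (f x)) M) => // x.
  exact: le_trans (Re_le_l1norm _) (fM x).
apply: (@integrable_dominated (fun x => Im (f x)) M) => // x.
exact: le_trans (Im_le_l1norm _) (fM x).
Qed.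

Lemma cintegralB f g : cintegrable f -> cintegrable g ->
  cintegral (fun x => f x - g x) = cintegral f - cintegral g.
Proof.
move=> [fR fI] [gR gI].
transitivity ((\int[mu n]_x (Re (f x) - Re (g x)))%R +i*
    (\int[mu n]_x (Im (f x) - Im (g x)))%R).
  congr (_ +i* _); apply: eq_Rintegral => x _; [exact: ReB|exact: ImB].
by rewrite !RintegralB.
Qed.

Lemma cintegralZ (z : R[i]) f : cintegrable f ->
  cintegral (fun x => z * f x) = z * cintegral f.
Proof.
move=> [fR fI].
have iZ (r : R) u : (mu n).-integrable setT (EFin \o u) ->
    (mu n).-integrable setT (fun x => (r * u x)%:E).
  by move=> iu; apply: (integrableZl measurableT r iu).
transitivity ((\int[mu n]_x (Re z * Re (f x) - Im z * Im (f x)))%R +i*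
    (\int[mu n]_x (Re z * Im (f x) + Im z * Re (f x)))%R).
  congr (_ +i* _); apply: eq_Rintegral => x _; [exact: ReM|exact: ImM].
rewrite RintegralB//; [|exact: iZ|exact: iZ].
rewrite RintegralD//; [|exact: iZ|exact: iZ].
by rewrite !RintegralZl//; case: z.
Qed.

Lemma cintegral_shift (c : 'rV[R]_n) f : cmeasurable f ->
  cintegral (fun x => f (x + c)) = cintegral f.
Proof.
move=> [fR fI]; rewrite /cintegral /Rintegral.
rewrite (integral_rV_shift c (f := fun x => (Re (f x))%:E)).
  rewrite (integral_rV_shift c (f := fun x => (Im (f x))%:E))//.
  exact/measurable_EFinP.
exact/measurable_EFinP.
Qed.

Lemma cintegral_swap (f : 'rV[R]_n * 'rV[R]_n -> R[i]) M :
  cmeasurable f ->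
  (forall y z, l1norm (f (y, z)) <= M * (weight y * weight z)) ->
  cintegral (fun y => cintegral (fun z => f (y, z))) =
  cintegral (fun z => cintegral (fun y => f (y, z))).
Proof.
move=> [fR fI] fM; apply/eqP; rewrite eq_complex /=; apply/andP; split.
  apply/eqP; apply: (@Rintegral_swap (fun x => Re (f x)) M) => // y z.
  exact: le_trans (Re_le_l1norm _) (fM y z).
apply/eqP; apply: (@Rintegral_swap (fun x => Im (f x)) M) => // y z.
exact: le_trans (Im_le_l1norm _) (fM y z).
Qed.

(** The real and imaginary integrals are each bounded by the integral of the majorant, hence the
    factor 2. *)
Lemma l1norm_cintegral f M :
  cmeasurable f -> (forall x, l1norm (f x) <= M * weight x) ->
  l1norm (cintegral f) <= 2 * M * \int[mu n]_x weight x.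
Proof.
move=> mf fM.
have [fR fI] := cintegrable_dominated mf fM.
have iw := @integrable_weight R n.
have H (u : 'rV[R]_n -> R) : (mu n).-integrable setT (EFin \o u) ->
    (forall x, `|u x| <= l1norm (f x)) ->
    `|\int[mu n]_x u x| <= M * \int[mu n]_x weight x.
  move=> iu uf; rewrite -RintegralZl//.
  apply: le_trans (le_normr_Rintegral measurableT iu) _.
  apply: le_Rintegral => //.
  - exact: integrable_norm.
  - exact: (integrableZl measurableT M iw).
  - by move=> x _; exact: le_trans (uf x) (fM x).
rewrite -mulrA mulr2n mulrDl !mul1r lerD//; apply: H => // x.
  exact: Re_le_l1norm.
exact: Im_le_l1norm.
Qed.

End fixed_dimension.
End cintegral.

(** * Convolution *)

Lemma continuous_linear_combination (R : realType) (T : topologicalType)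
    (a b : R) (u v : T -> R) :
  continuous u -> continuous v -> continuous (fun x => a * u x + b * v x).
Proof.
move=> cu cv x; apply: cvgD.
  by apply: cvgM; [exact: cvg_cst|exact: cu].
by apply: cvgM; [exact: cvg_cst|exact: cv].
Qed.

Section convolution.
Context {R : realType} {n : nat}.
Local Notation mu := (@lebesgue_rV R).
Local Notation Re := complex.Re.
Local Notation Im := complex.Im.
Implicit Types (f g h : 'rV[R]_n -> R[i]) (x y : 'rV[R]_n).

Definition ccontinuous f :=
  continuous (fun x => Re (f x)) /\ continuous (fun x => Im (f x)).

Definition cbounded f := exists M, forall x, l1norm (f x) <= M.

(** The only trace of rapid decrease that the convolution estimates use: it gives integrability, and
    it survives reflection about any point. *)
Definition cdominated f := exists M, forall x, l1norm (f x) <= M * weight x.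

Lemma ccontinuous_measurable f : ccontinuous f -> cmeasurable f.
Proof. by move=> [? ?]; split; exact: continuous_measurable_rV. Qed.

Lemma cdominated_bounded f : cdominated f -> cbounded f.
Proof.
move=> [M fM]; exists `|M| => x; apply: le_trans (fM x) _.
apply: le_trans (ler_norm _) _.
by rewrite normrM ler_piMr// ger0_norm ?weight_ge0// weight_le1.
Qed.

Lemma cdominatedM f g : cdominated f -> cbounded g ->
  cdominated (fun x => f x * g x).
Proof.
move=> [M fM] [N gN]; exists (M * N) => x; apply: le_trans (l1normM _ _) _.
by rewrite mulrAC ler_pM ?l1norm_ge0.
Qed.

Lemma cdominated_reflect f x : cdominated f -> cdominated (fun y => f (x - y)).
Proof.
move=> [M fM].
(* The sign of [M] can be read off the hypothesis at any single point, since the weight is positive;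
   it is needed to multiply Peetre's inequality by [M]. *)
have M0 : 0 <= M.
  by rewrite -(pmulr_lge0 _ (weight_gt0 x)) (le_trans _ (fM x)) ?l1norm_ge0.
exists (M * (2 ^+ n / weight x)) => y; apply: le_trans (fM _) _.
by rewrite -mulrA ler_wpM2l// weight_sub.
Qed.

Lemma cbounded_reflect f x : cbounded f -> cbounded (fun y => f (x - y)).
Proof. by move=> [M fM]; exists M. Qed.

Lemma cmeasurable_reflect f x : cmeasurable f -> cmeasurable (fun y => f (x - y)).
Proof.
by move=> mf; apply: (cmeasurable_comp mf); exact: measurable_sub_rV.
Qed.

Lemma cdominated_integrable f : cmeasurable f -> cdominated f -> cintegrable f.
Proof. by move=> mf [M fM]; exact: cintegrable_dominated fM. Qed.

Lemma cbounded_convolution f g : cmeasurable f -> cmeasurable g ->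
  cdominated f -> cbounded g -> cbounded (convolution f g).
Proof.
move=> mf mg [M fM] [N gN].
exists (2 * (M * N) * \int[mu n]_x weight x)%R => x.
apply: l1norm_cintegral => [|y].
  exact/cmeasurableM/cmeasurable_reflect.
by rewrite (le_trans (l1normM _ _))// mulrAC ler_pM ?l1norm_ge0.
Qed.

(** Dominated convergence speaks of sequences, so continuity is tested on them: a failure at level
    [e] yields bad points in the balls of radius [1 / (k + 1)], which form a sequence tending to
    [x]. *)
Lemma sequential_continuity (u : 'rV[R]_n -> R) x :
  (forall s : nat -> 'rV[R]_n, s @ \oo --> x -> (u \o s) @ \oo --> u x) ->
  u @ x --> u x.
Proof.
move=> us; apply/(@cvgrPdist_lt _ _ _ (nbhs x)) => e e0; apply: contrapT => nA.
have H k : exists y, ball x k.+1%:R^-1 y /\ ~ (`|u x - u y| < e).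
  apply: contrapT => /forallNP ny; apply: nA; apply/nbhs_ballP.
  exists k.+1%:R^-1 => [|y By] /=; first by rewrite invr_gt0.
  by apply: contrapT => h; apply: (ny y).
have [s Hs] := choice H.
have sx : s @ \oo --> x.
  apply/cvg_ballP => d d0; near=> k; apply: le_ball (Hs k).1.
  by apply: ltW; near: k; exact: (near_infty_natSinv_lt (PosNum d0)).
have /cvgrPdist_lt /(_ e e0) [N _ hN] := us s sx.
exact: (Hs N).2 (hN N (leqnn N)).
Unshelve. all: by end_near. Qed.

Lemma continuous_Rintegral_dominated (k : 'rV[R]_n -> 'rV[R]_n -> R) M :
  (forall x, measurable_fun setT (k x)) ->
  (forall y, continuous (k ^~ y)) ->
  (forall x y, `|k x y| <= M * weight y) ->
  continuous (fun x => \int[mu n]_y k x y)%R.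
Proof.
move=> mk ck kM x; apply: sequential_continuity => s sx.
have ik z : (mu n).-integrable setT (EFin \o k z).
  exact: (integrable_dominated (mk z) (kM z)).
apply: fine_cvg; rewrite fineK; last exact: (integrable_fin_num measurableT (ik x)).
apply: (@dominated_cvg _ _ _ (mu n) setT measurableT
  (fun j y => (k (s j) y)%:E) (fun y => (k x y)%:E)
  (fun y => (M * weight y)%:E)) => //.
- by move=> j; exact/measurable_EFinP.
- move=> y _; apply: cvg_EFin; first exact: nearW.
  exact: (cvg_comp _ _ sx (ck y x)).
- exact: (integrableZl measurableT M (@integrable_weight R n)).
- by move=> j y _ /=; rewrite lee_fin.
Qed.

(** The parameter [x] occurs only inside [g], which thus provides continuity of the integrand, while
    [f] provides a majorant independent of [x]. *)
Lemma ccontinuous_convolution f g : cmeasurable f -> ccontinuous g ->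
  cdominated f -> cbounded g -> ccontinuous (convolution f g).
Proof.
move=> mf cg [M fM] [N gN].
have mfg x : cmeasurable (fun y => f y * g (x - y)).
  apply: cmeasurableM => //; apply: cmeasurable_reflect.
  exact: ccontinuous_measurable.
have fgM x y : l1norm (f y * g (x - y)) <= M * N * weight y.
  by rewrite (le_trans (l1normM _ _))// mulrAC ler_pM ?l1norm_ge0.
have cs y : continuous (fun x => x - y).
  by move=> x; apply: continuousB; [exact: cvg_id|exact: cst_continuous].
have [cgR cgI] : (forall y, continuous (fun x => Re (g (x - y)))) /\
    (forall y, continuous (fun x => Im (g (x - y)))).
  split=> y x.
    apply: (@continuous_comp _ _ _ (fun x => x - y) (fun z => Re (g z)) x (cs y x)).
    exact: cg.1.
  apply: (@continuous_comp _ _ _ (fun x => x - y) (fun z => Im (g z)) x (cs y x)).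
  exact: cg.2.
split.
  apply: (@continuous_Rintegral_dominated _ (M * N)) => [x|y|x y].
  - exact: (mfg x).1.
  - rewrite (_ : (fun x => Re _) = (fun x =>
        Re (f y) * Re (g (x - y)) + (- Im (f y)) * Im (g (x - y)))).
      exact: continuous_linear_combination.
    by apply/funext => x; rewrite ReM mulNr.
  - exact: le_trans (Re_le_l1norm _) (fgM x y).
apply: (@continuous_Rintegral_dominated _ (M * N)) => [x|y|x y].
- exact: (mfg x).2.
- rewrite (_ : (fun x => Im _) = (fun x =>
      Re (f y) * Im (g (x - y)) + Im (f y) * Re (g (x - y)))).
    exact: continuous_linear_combination.
  by apply/funext => x; rewrite ImM.
- exact: le_trans (Im_le_l1norm _) (fgM x y).
Qed.

(** Fubini for the kernel [K]: [f] brings decay in [z], [h] brings decay in [y] by Peetre's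
    inequality at the fixed point [x], and the middle factor contributes a mere bound. *)
Lemma convolutionA f g h x :
  cmeasurable f -> cmeasurable g -> cmeasurable h ->
  cdominated f -> cbounded g -> cdominated h ->
  convolution (convolution f g) h x = convolution f (convolution g h) x.
Proof.
move=> mf mg mh df bg dh.
pose K (p : 'rV[R]_n * 'rV[R]_n) := f p.2 * g (p.1 - p.2) * h (x - p.1).
transitivity (cintegral (fun y => cintegral (fun z => K (y, z)))).
  congr cintegral; apply/funext => y; rewrite mulrC -cintegralZ.
    by congr cintegral; apply/funext => z; rewrite /K /= mulrC.
  apply: cdominated_integrable.
    exact/cmeasurableM/cmeasurable_reflect.
  exact/cdominatedM/cbounded_reflect.
have [M fM] := df; have [N gN] := bg; have [P hP] := cdominated_reflect x dh.
rewrite (@cintegral_swap _ _ K (M * N * P)).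
- congr cintegral; apply/funext => z; rewrite /convolution -cintegralZ.
    (* Substituting [y - z] for [y] turns [g y] into [g (y - z)] and [h (x - z - y)] into
       [h (x - y)], which is the kernel [K]. *)
    rewrite -[RHS](cintegral_shift (- z)).
      congr cintegral; apply/funext => y; rewrite /K /= -mulrA.
      by rewrite opprB addrA addrNK.
    apply: cmeasurableM; first exact: cmeasurable_cst.
    by apply: cmeasurableM => //; exact: cmeasurable_reflect.
  apply: cdominated_integrable.
    by apply: cmeasurableM => //; exact: cmeasurable_reflect.
  under [X in cdominated X]eq_fun do rewrite mulrC.
  by apply: cdominatedM => //; exact: cdominated_reflect.
- have m1 : measurable_fun setT (fun p : 'rV[R]_n * 'rV[R]_n => p.1).
    exact: measurable_fst.
  have m2 : measurable_fun setT (fun p : 'rV[R]_n * 'rV[R]_n => p.2).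
    exact: measurable_snd.
  apply: cmeasurableM; last first.
    by apply: (cmeasurable_comp mh); exact: measurable_sub_rV.
  apply: cmeasurableM; first exact: (cmeasurable_comp mf).
  by apply: (cmeasurable_comp mg); exact: measurable_sub_rV.
- move=> y z; rewrite /K /=.
  apply: le_trans (l1normM _ _) _.
  apply: (@le_trans _ _ ((M * weight z * N) * (P * weight y))).
    apply: ler_pM; rewrite ?l1norm_ge0//.
    by apply: le_trans (l1normM _ _) _; rewrite ler_pM ?l1norm_ge0.
  suff -> : M * weight z * N * (P * weight y) =
      M * N * P * (weight y * weight z) by [].
  by ring.
Qed.

End convolution.

(** * Gaussians are Schwartz functions *)

Section gaussian.
Context {R : realType} {n : nat}.
Implicit Types (u v : 'rV[R]_n -> R) (x y : 'rV[R]_n) (k : R).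

Definition sqnorm x : R := \sum_(i < n) x ord0 i ^+ 2.

Lemma sqnorm_ge0 x : 0 <= sqnorm x.
Proof. by apply: sumr_ge0 => i _; exact: sqr_ge0. Qed.

Lemma sqr_coord_le_sqnorm x i : x ord0 i ^+ 2 <= sqnorm x.
Proof.
rewrite /sqnorm (bigD1 i)//= lerDl; apply: sumr_ge0 => j _; exact: sqr_ge0.
Qed.

Lemma derive_coord x (h : 'rV[R]_n) i :
  'D_h (fun y : 'rV[R]_n => y ord0 i) x = h ord0 i.
Proof.
have := derive_mx (@derivable_id _ _ x h); rewrite derive_id => /matrixP /(_ ord0 i).
by rewrite mxE.
Qed.

Lemma differentiable_sqnorm x : differentiable sqnorm x.
Proof.
rewrite (_ : sqnorm = \sum_(i < n) (fun y : 'rV[R]_n => y ord0 i) ^+ 2).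
  apply: differentiable_sum => i; apply: differentiableX.
  exact: differentiable_coord.
by apply/funext => y; rewrite fct_sumE.
Qed.

Lemma partial_sqnorm j x : partial j sqnorm x = 2 * x ord0 j.
Proof.
rewrite /partial (_ : sqnorm =
    \sum_(i < n) (fun y : 'rV[R]_n => y ord0 i) ^+ 2); last first.
  by apply/funext => y; rewrite fct_sumE.
rewrite derive_sum => [|i]; last first.
  apply: derivableX; apply: diff_derivable; exact: differentiable_coord.
rewrite (bigD1 j)//= big1 => [|i ij].
  rewrite addr0 deriveX; last exact/diff_derivable/differentiable_coord.
  by rewrite derive_coord mxE !eqxx /= expr1 [_ *: _]mulr1 mulr_natl.
rewrite deriveX; last exact/diff_derivable/differentiable_coord.
by rewrite derive_coord mxE (negbTE ij) andbF scaler0.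
Qed.

Lemma differentiable_expR_comp u x :
  differentiable u x -> differentiable (fun y => expR (u y)) x.
Proof.
move=> du; apply: (differentiable_comp du).
by apply/derivable1_diffP; exact: derivable_expR.
Qed.

Lemma partial_expR_comp j u x : differentiable u x ->
  partial j (fun y => expR (u y)) x = partial j u x * expR (u x).
Proof.
move=> du; have de : differentiable expR (u x).
  by apply/derivable1_diffP; exact: derivable_expR.
rewrite /partial deriveE; last exact: differentiable_expR_comp.
rewrite (diff_comp du de) /= (deriveE _ du) diff1E//.
rewrite derive1E; congr (_ * _); exact: derive_val.
Qed.

(** These are the polynomials times [expR (- k * sqnorm x)]. The class is closed under partial
    derivatives and under multiplication by monomials, so every Schwartz seminorm of a member
    reduces to the boundedness of another member. *)
Inductive gaussian_class k : ('rV[R]_n -> R) -> Prop :=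
| gaussian_class_expR : gaussian_class k (fun x => expR (- k * sqnorm x))
| gaussian_class_coord i u :
    gaussian_class k u -> gaussian_class k (fun x => x ord0 i * u x)
| gaussian_class_lin a b u v : gaussian_class k u -> gaussian_class k v ->
    gaussian_class k (fun x => a * u x + b * v x).

Lemma gaussian_class_scale k a u :
  gaussian_class k u -> gaussian_class k (fun x => a * u x).
Proof.
move=> gu; rewrite (_ : (fun x => _) = (fun x => a * u x + 0 * u x)).
  exact: gaussian_class_lin.
by apply/funext => x; rewrite mul0r addr0.
Qed.

Lemma gaussian_class_differentiable k u x :
  gaussian_class k u -> differentiable u x.
Proof.
elim=> [|i v _ dv|a b v w _ dv _ dw].
- apply: differentiable_expR_comp; apply: differentiableZ.
  exact: differentiable_sqnorm.
- by apply: differentiableM => //; exact: differentiable_coord.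
- by apply: differentiableD; apply: differentiableZ.
Qed.

Lemma gaussian_class_partial k j u :
  gaussian_class k u -> gaussian_class k (partial j u).
Proof.
have dc x i : derivable (fun y : 'rV[R]_n => y ord0 i) x (delta_mx ord0 j).
  exact/diff_derivable/differentiable_coord.
have dg v x : gaussian_class k v -> derivable v x (delta_mx ord0 j).
  by move=> gv; exact/diff_derivable/(gaussian_class_differentiable _ gv).
elim=> [|i v gv gpv|a b v w gv gpv gw gpw].
- rewrite (_ : partial _ _ = fun x => (- k * 2) *
      (x ord0 j * expR (- k * sqnorm x))).
    exact: (gaussian_class_scale _ (gaussian_class_coord _ (gaussian_class_expR k))).
  apply/funext => x; rewrite partial_expR_comp; last first.
    by apply: differentiableZ; exact: differentiable_sqnorm.
  rewrite /partial deriveZ; last exact/diff_derivable/differentiable_sqnorm.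
  by rewrite -/(partial j sqnorm x) partial_sqnorm /GRing.scale /= !mulrA.
- rewrite (_ : partial _ _ = fun x =>
      1 * (x ord0 i * partial j v x) + (i == j)%:R * v x).
    by apply: gaussian_class_lin => //; exact: gaussian_class_coord.
  apply/funext => x; rewrite /partial deriveM//; last exact: dg.
  rewrite derive_coord mxE eqxx mul1r; congr (_ + _); exact: mulrC.
- rewrite (_ : partial _ _ = fun x => a * partial j v x + b * partial j w x).
    exact: gaussian_class_lin.
  apply/funext => x; rewrite /partial deriveD.
  + by rewrite !deriveZ//; exact: dg.
  + by apply: derivableZ; exact: dg.
  + by apply: derivableZ; exact: dg.
Qed.

Lemma gaussian_class_partials k s u :
  gaussian_class k u -> gaussian_class k (partials s u).
Proof. by move=> gu; elim: s => //= i s; exact: gaussian_class_partial. Qed.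

Lemma gaussian_class_monomial k alpha u :
  gaussian_class k u -> gaussian_class k (fun x => monomial alpha x * u x).
Proof.
move=> gu; rewrite /monomial.
elim: (index_enum _) => [|i s IH].
  rewrite (_ : (fun x => _) = u)//.
  by apply/funext => x; rewrite big_nil mul1r.
rewrite (_ : (fun x => _) = (fun x => x ord0 i ^+ alpha i *
    (\prod_(j <- s) x ord0 j ^+ alpha j * u x))); last first.
  by apply/funext => x; rewrite big_cons mulrA.
elim: (alpha i) => [|m IHm].
  rewrite (_ : (fun x => _) = (fun x => \prod_(j <- s) x ord0 j ^+ alpha j * u x))//.
  by apply/funext => x; rewrite expr0 mul1r.
rewrite (_ : (fun x => _) = (fun x => x ord0 i * (x ord0 i ^+ m *
    (\prod_(j <- s) x ord0 j ^+ alpha j * u x)))).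
  exact: gaussian_class_coord.
by apply/funext => x; rewrite exprS -mulrA.
Qed.

(* The loss of exponent, from [k] to [s], absorbs the polynomial factors. *)
Lemma gaussian_class_le k u s : gaussian_class k u -> s < k ->
  exists M, forall x, `|u x| <= M * expR (- s * sqnorm x).
Proof.
move=> gu; elim: gu s => [s sk|i v _ IH s sk|a b v w _ IHv _ IHw s sk].
- exists 1 => x; rewrite ger0_norm ?expR_ge0// mul1r ler_expR !mulNr lerN2.
  by rewrite ler_wpM2r ?sqnorm_ge0// ltW.
(* The gap between [s] and [k] is split: [v] decays at the intermediate rate [t], and what remains
   pays for the coordinate, since [1 + (t - s) * sqnorm x] is at most its exponential. *)
- pose t := (s + k) / 2; have st : s < t by rewrite /t; lra.
  have tk : t < k by rewrite /t; lra.
  have [M vM] := IH t tk.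
  exists ((1 + (t - s)^-1) * M) => x; rewrite normrM.
  have ts : 0 < t - s by rewrite subr_gt0.
  have -> : - s * sqnorm x = (t - s) * sqnorm x + - t * sqnorm x by ring.
  rewrite expRD mulrACA ler_pM//.
  have le1 : `|x ord0 i| <= 1 + sqnorm x.
    have := sqr_coord_le_sqnorm x i; rewrite -real_normK ?num_real//.
    by have := normr_ge0 (x ord0 i); nra.
  apply: le_trans le1 _.
  apply: (@le_trans _ _ ((1 + (t - s)^-1) * (1 + (t - s) * sqnorm x))).
    have -> : (1 + (t - s)^-1) * (1 + (t - s) * sqnorm x) =
        1 + sqnorm x + ((t - s)^-1 + (t - s) * sqnorm x).
      by field; rewrite gt_eqF.
    by rewrite lerDl addr_ge0 ?invr_ge0 ?mulr_ge0 ?sqnorm_ge0 ?ltW.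
  by rewrite ler_wpM2l ?expR_ge1Dx// addr_ge0 ?invr_ge0 ?ltW.
- have [M vM] := IHv s sk; have [N wN] := IHw s sk.
  exists (`|a| * M + `|b| * N) => x; apply: le_trans (ler_normD _ _) _.
  by rewrite !normrM mulrDl -!mulrA lerD// ler_wpM2l.
Qed.

Lemma gaussian_class_bounded k u : 0 < k -> gaussian_class k u ->
  exists M, forall x, `|u x| <= M.
Proof.
move=> k0 gu; have [M uM] := gaussian_class_le gu k0; exists M => x.
by have := uM x; rewrite oppr0 mul0r expR0 mulr1.
Qed.

Lemma gaussian_class_schwartz k u : 0 < k -> gaussian_class k u ->
  is_schwartz (fun x => (u x)%:C).
Proof.
move=> k0 gu.
have H v : gaussian_class k v -> forall s, (continuous (partials s v) /\
    forall i x, derivable (partials s v) x (delta_mx ord0 i)) /\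
    forall alpha, exists M, forall x, `|monomial alpha x * partials s v x| <= M.
  move=> gv s; have gp := gaussian_class_partials s gv.
  split; first split.
  - by move=> x; exact/differentiable_continuous/(gaussian_class_differentiable _ gp).
  - by move=> i x; exact/diff_derivable/(gaussian_class_differentiable _ gp).
  - move=> alpha.
    exact: (gaussian_class_bounded k0 (gaussian_class_monomial alpha gp)).
apply/is_schwartz_components; split; first exact: H.
(* Written as a null multiple of [u], the zero imaginary part belongs to the class and [H] covers it
   too. *)
rewrite (_ : (fun x => complex.Im _) = (fun x => 0 * u x)).
  exact: (H _ (gaussian_class_scale 0 gu)).
by apply/funext => x; rewrite mul0r.
Qed.

(** The amplitude [c] is a parameter because surjectivity of [T] is invoked separately for each
    amplitude. *)
Definition gaussian k (k0 : 0 < k) (c : R) : schwartz R n :=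
  Schwartz (gaussian_class_schwartz k0
    (gaussian_class_scale c (gaussian_class_expR k))).

End gaussian.

(** * Gaussian integrals determine a bounded continuous function *)

Section laplace.
Context {R : realType} {n : nat}.
Local Notation mu := (@lebesgue_rV R).
Implicit Types (q : 'rV[R]_n -> R) (x y : 'rV[R]_n).

(** Expanding the product of the [1 + x_i ^ 2] over subsets of the indices: finitely many monomial
    bounds then control a function divided by the weight. *)
Lemma prod_oneDsqr_monomials x : (weight x)^-1 = \sum_(J : {set 'I_n})
  monomial (fun i => if i \in J then 2 else 0)%N x.
Proof.
rewrite /weight -prodfV (eq_bigr (fun i => x ord0 i ^+ 2 + 1)) => [|i _].
  rewrite (bigA_distr 1 +%R) /=; apply: eq_bigr => J _; apply: eq_bigr => i _.
  by case: ifP => // _; rewrite expr0.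
by rewrite invrK addrC.
Qed.

Lemma schwartz_cdominated (f : schwartz R n) : cdominated f.
Proof.
have H (J : {set 'I_n}) : exists M, forall x,
    l1norm (f x) * monomial (fun i => if i \in J then 2 else 0)%N x <= M.
  have [M HM] := (schwartzP f).2 (fun i => if i \in J then 2 else 0)%N [::].
  exists (M + M) => x; set m := monomial _ x.
  have := normc_le_real (HM x); rewrite -/m.
  have -> : cpartials [::] f x = f x by rewrite /cpartials /=; case: (f x).
  rewrite ReM ImM /= !mul0r subr0 addr0 => -[hR hI].
  apply: (@le_trans _ _ (l1norm (f x) * `|m|)).
    by rewrite ler_wpM2l ?l1norm_ge0// ler_norm.
  (* The modulus bound [M] applies to each component, which explains the witness [M + M]. *)
  by rewrite /l1norm mulrDl -!normrM ![_ * m]mulrC lerD.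
have [M HM] := choice H; exists (\sum_(J : {set 'I_n}) M J) => x.
rewrite -ler_pdivrMr ?weight_gt0// prod_oneDsqr_monomials mulr_sumr.
by apply: ler_sum => J _.
Qed.

Lemma schwartz_ccontinuous (f : schwartz R n) : ccontinuous f.
Proof. by have [[/(_ [::])[cR _] /(_ [::])[cI _]] _] := schwartzP f. Qed.

Lemma schwartz_cmeasurable (f : schwartz R n) : cmeasurable f.
Proof. exact/ccontinuous_measurable/schwartz_ccontinuous. Qed.

Lemma integrable_indic_box (A : 'I_n -> set R) :
  (forall i, measurable (A i)) ->
  (forall i, (lebesgue_measure (A i) < +oo)%E) ->
  (mu n).-integrable setT
    (EFin \o \1_[set x : 'rV[R]_n | forall i, A i (x ord0 i)]).
Proof.
move=> mA fA; have mB := measurable_box mA; apply/integrableP; split.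
  by apply/measurable_EFinP.
under eq_integral do rewrite /= ger0_norm//.
rewrite integral_indic// setIT lebesgue_rV_box// ltey_eq; apply/orP; left.
elim/big_ind : _ => //; first by move=> u v uf vf; rewrite fin_numM.
by move=> i _; rewrite ge0_fin_numE// fA.
Qed.

Lemma Rintegral_indic_box (r : R) x : 0 <= r ->
  (\int[mu n]_y \1_[set y : 'rV[R]_n | forall i,
    `](x ord0 i - r), (x ord0 i + r)[%classic (y ord0 i)] y)%R = (2 * r) ^+ n.
Proof.
move=> r0; pose A (i : 'I_n) : set R := `](x ord0 i - r), (x ord0 i + r)[%classic.
have mA i : measurable (A i) by exact: measurable_itv.
rewrite /Rintegral integral_indic//; last exact: (measurable_box mA).
rewrite setIT (lebesgue_rV_box mA).
rewrite (eq_bigr (fun=> (2 * r)%:E)) ?prodEFin/= ?prodr_const ?card_ord// => i _.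
rewrite lebesgue_measure_itv/= lte_fin -EFinB.
case: ifPn; first by move=> _; congr EFin; ring.
by rewrite -leNgt => h; congr EFin; lra.
Qed.

Lemma gaussian_dominated k x : 0 < k ->
  exists M, forall y, expR (- k * sqnorm (x - y)) <= M * weight y.
Proof.
move=> k0; have [M HM] := cdominated_reflect x (schwartz_cdominated (gaussian k0 1)).
exists M => y; apply: le_trans (HM y); apply: le_trans (Re_le_l1norm _) => /=.
by rewrite mul1r ler_norm.
Qed.

Lemma measurable_gaussian_reflect k x :
  measurable_fun setT (fun y => expR (- k * sqnorm (x - y))).
Proof.
have cg : continuous (fun y => expR (- k * sqnorm y)).
  move=> y; apply: differentiable_continuous.
  exact: (gaussian_class_differentiable _ (gaussian_class_expR k)).
apply: (measurableT_comp (continuous_measurable_rV cg)).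
exact: measurable_sub_rV.
Qed.

(* Laplace's method: as k grows, the weight concentrates at x. *)
Lemma gaussian_Rintegrals_eq0_le0 q (A : R) x :
  continuous q -> (forall y, `|q y| <= A) ->
  (forall k : R, 0 < k ->
    (\int[mu n]_y (q y * expR (- k * sqnorm (x - y))))%R = 0) ->
  q x <= 0.
Proof.
move=> cq qA q0; rewrite leNgt; apply/negP => qx0.
have A0 : 0 <= A := le_trans (normr_ge0 _) (qA x).
pose c := q x / 2; have c0 : 0 < c by rewrite divr_gt0.
have [d /= d0 dq] : nbhs_ball x [set y | c < q y].
  apply/nbhs_ballP; have := cq x => /cvgrPdist_lt /(_ c c0).
  apply: filterS => y /=; rewrite ltr_norml => /andP[_].
  by rewrite /c; lra.
(* Small enough that the box of half-width [r] lies in the sup-norm ball of radius [d] and has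
   [sqnorm (x - y) <= n * r ^ 2 <= d ^ 2 / 2], against at least [d ^ 2] off the ball; [n.+1] keeps
   the denominator nonzero in dimension 0. *)
pose r := d / (2 * n.+1%:R); have r0 : 0 < r by rewrite divr_gt0// mulr_gt0.
pose I i : set R := `](x ord0 i - r), (x ord0 i + r)[%classic.
pose B : set 'rV[R]_n := [set y | forall i, I i (y ord0 i)].
have mI i : measurable (I i) by exact: measurable_itv.
have nearB y : B y -> sqnorm (x - y) <= d ^+ 2 / 2 /\ c < q y.
  move=> By.
  have h i : `|x ord0 i - y ord0 i| < r.
    by have := By i; rewrite /I /= in_itv/= ltr_distlC.
  have rd : r * (2 * n.+1%:R) = d by rewrite divfK// mulf_neq0.
  have n1 : 1 <= n.+1%:R :> R by rewrite ler1n.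
  split; last first.
    apply: dq; split => // i j; rewrite ord1; apply: lt_le_trans (h j) _; nra.
  apply: (@le_trans _ _ (\sum_(i < n) r ^+ 2)).
    apply: ler_sum => i _; rewrite !mxE -(real_normK (num_real (_ - _))).
    by rewrite ler_sqr ?nnegrE ?(ltW (h i)) ?(ltW r0).
  rewrite sumr_const card_ord -mulr_natr.
  have nn : n%:R <= n.+1%:R :> R by rewrite ler_nat.
  have n0 : 0 <= n%:R :> R by [].
  rewrite -rd; have := sqr_ge0 r; nra.
have far y : ~ c < q y -> d ^+ 2 <= sqnorm (x - y).
  move=> nq; rewrite leNgt; apply/negP => h; apply: nq; apply: dq; split => // i j.
  rewrite ord1 /ball /=.
  have := le_lt_trans (sqr_coord_le_sqnorm (x - y) j) h.
  by rewrite !mxE -(real_normK (num_real (_ - _))) ltr_sqr ?nnegrE ?(ltW d0).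
have [M1 HM1] := gaussian_dominated x (@ltr01 R).
pose psi k y := expR (- k * sqnorm (x - y)).
have ipsi : (mu n).-integrable setT (EFin \o psi 1).
  apply: (integrable_dominated (measurable_gaussian_reflect 1 x)) => y.
  by rewrite ger0_norm ?expR_ge0.
have iB : (mu n).-integrable setT (EFin \o \1_B).
  apply: integrable_indic_box => // i.
  by rewrite lebesgue_measure_itv/=; case: ifP => _; rewrite ?ltry.
pose J := (\int[mu n]_y psi 1 y)%R.
have J0 : 0 <= J by apply: Rintegral_ge0 => y _; exact: expR_ge0.
(* Left: what the box contributes at least. Right: the most that the points with [q y <= c] can take
   away. The rates [k / 2] and [k - 1] in front of [d ^ 2] make this impossible for large [k]. *)
have key k : 1 <= k -> c * expR (- k * (d ^+ 2 / 2)) * (2 * r) ^+ n <=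
    A * expR (- (k - 1) * d ^+ 2) * J.
  move=> k1; have k0 : 0 < k by lra.
  have [Mk HMk] := gaussian_dominated x k0.
  have iqk : (mu n).-integrable setT (EFin \o (fun y => q y * psi k y)).
    apply: (@integrable_dominated _ _ _ (A * Mk)) => [|y].
      apply: measurable_funM; first exact: continuous_measurable_rV.
      exact: measurable_gaussian_reflect.
    by rewrite normrM -mulrA ler_pM// ger0_norm ?expR_ge0//; exact: HMk.
  (* The volume of the box becomes the integral of its indicator and 0 becomes the vanishing
     integral, so that a pointwise comparison of integrands is enough. *)
  rewrite -(Rintegral_indic_box x (ltW r0)) -/B -subr_le0 -(q0 k k0).
  rewrite -!RintegralZl// -RintegralB//; last 2 first.
  - exact: (integrableZl measurableT _ iB).
  - exact: (integrableZl measurableT _ ipsi).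
  apply: le_Rintegral => // [|y _].
    exact: (integrableB measurableT (integrableZl measurableT _ iB)
      (integrableZl measurableT _ ipsi)).
  have psi0 j : 0 <= psi j y by exact: expR_ge0.
  have [cy|/far dy] := pselect (c < q y).
    apply: (@le_trans _ _ (c * psi k y)); last by rewrite ler_wpM2r// ltW.
    apply: (@le_trans _ _ (c * expR (- k * (d ^+ 2 / 2)) * \1_B y)).
      by rewrite gerBl (mulr_ge0 (mulr_ge0 A0 (expR_ge0 _)) (psi0 1)).
    rewrite -mulrA (ler_wpM2l (ltW c0))// indicE.
    have [/set_mem By|_] := boolP (y \in B); last by rewrite mulr0 psi0.
    rewrite mulr1 ler_expR !mulNr lerN2 ler_pM2l//.
    by have [] := nearB y By.
  rewrite indicE memNset ?mulr0 ?sub0r; last first.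
    by move=> /nearB [yd _]; have := exprn_gt0 2 d0; lra.
  rewrite -lerN2 opprK; apply: (@le_trans _ _ (A * psi k y)).
    rewrite (le_trans (ler_norm _))// normrN normrM (ger0_norm (psi0 k)).
    by rewrite ler_wpM2r.
  rewrite -mulrA ler_wpM2l// /psi -expRD ler_expR.
  (* One unit of [k] stays with [psi 1], for integrability; the other [k - 1] are evaluated at the
     least possible value [d ^ 2] of [sqnorm (x - y)]. *)
  have -> : - (k - 1) * d ^+ 2 + - 1 * sqnorm (x - y) =
    - k * sqnorm (x - y) + (k - 1) * (sqnorm (x - y) - d ^+ 2) by ring.
  by rewrite lerDl mulr_ge0 ?subr_ge0.
pose E := A * expR (d ^+ 2) * J.
have E0 : 0 <= E by exact: (mulr_ge0 (mulr_ge0 A0 (expR_ge0 _)) J0).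
pose V := c * (2 * r) ^+ n.
have V0 : 0 < V by apply: mulr_gt0 => //; apply: exprn_gt0; exact: mulr_gt0.
have d20 : 0 < d ^+ 2 by exact: exprn_gt0.
(* With [e = expR (- k * (d ^ 2 / 2))], [key] reads [e * V <= e * (E * e)], that is
   [V * expR (k * (d ^ 2 / 2)) <= E]. This [k] makes already [V * (1 + k * (d ^ 2 / 2))] exceed
   [E]. *)
pose k := 1 + 2 * E / (V * d ^+ 2).
have k1 : 1 <= k.
  rewrite lerDl; apply: divr_ge0; first exact: mulr_ge0.
  exact: (ltW (mulr_gt0 V0 d20)).
have := key k k1; apply/negP; rewrite -ltNge.
pose e := expR (- k * (d ^+ 2 / 2)); have e0 : 0 < e by exact: expR_gt0.
have -> : - (k - 1) * d ^+ 2 =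
    d ^+ 2 + (- k * (d ^+ 2 / 2) + - k * (d ^+ 2 / 2)) by field.
rewrite !expRD -/e.
have -> : A * (expR (d ^+ 2) * (e * e)) * J = e * (E * e) by rewrite /E; ring.
have -> : c * e * (2 * r) ^+ n = e * V by rewrite /V; ring.
rewrite ltr_pM2l// /e mulNr expRN ltr_pdivrMr ?expR_gt0//.
apply: lt_le_trans (ler_wpM2l (ltW V0) (expR_ge1Dx _)).
have -> : V * (1 + k * (d ^+ 2 / 2)) = E + V * (1 + d ^+ 2 / 2).
  by rewrite /k; field; rewrite !gt_eqF.
by rewrite ltrDl (mulr_gt0 V0)// (addr_gt0 ltr01)// divr_gt0.
Qed.

(** The one-sided estimate is applied to [q] and to [- q], which satisfies the same hypotheses. *)
Lemma gaussian_Rintegrals_eq0 q (A : R) x :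
  continuous q -> (forall y, `|q y| <= A) ->
  (forall k : R, 0 < k ->
    (\int[mu n]_y (q y * expR (- k * sqnorm (x - y))))%R = 0) ->
  q x = 0.
Proof.
move=> cq qA q0; apply: le_anti; rewrite (gaussian_Rintegrals_eq0_le0 cq qA q0)/=.
rewrite -oppr_le0; apply: (@gaussian_Rintegrals_eq0_le0 (fun y => - q y) A).
- by move=> y; apply: continuousN; exact: cq.
- by move=> y; rewrite normrN.
move=> k k0; have [M HM] := gaussian_dominated x k0.
transitivity (-1 * \int[mu n]_y (q y * expR (- k * sqnorm (x - y))))%R.
  rewrite -RintegralZl//; first by apply: eq_Rintegral => y _; rewrite mulN1r mulNr.
  apply: (@integrable_dominated _ _ _ (A * M)) => [|y].
    apply: measurable_funM; first exact: continuous_measurable_rV.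
    exact: measurable_gaussian_reflect.
  by rewrite normrM -mulrA ler_pM// ger0_norm ?expR_ge0.
by rewrite q0// mulr0.
Qed.

End laplace.

(** * The multiplicativity defect *)

Lemma l1norm_le_normc (R : realType) (z : R[i]) (a : R) :
  `|z| <= a%:C -> l1norm z <= 2 * a.
Proof. by move=> /normc_le_real[? ?]; rewrite mulr2n mulrDl !mul1r lerD. Qed.

Lemma convolutionBl (R : realType) n (f1 f2 g : 'rV[R]_n -> R[i]) x :
  cmeasurable f1 -> cmeasurable f2 -> cmeasurable g ->
  cbounded f1 -> cbounded f2 -> cdominated g ->
  convolution (fun y => f1 y - f2 y) g x =
  convolution f1 g x - convolution f2 g x.
Proof.
move=> mf1 mf2 mg bf1 bf2 dg.
have ifg (f : 'rV[R]_n -> R[i]) : cmeasurable f -> cbounded f ->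
    cintegrable (fun y => f y * g (x - y)).
  move=> mf bf; apply: cdominated_integrable.
    by apply: cmeasurableM => //; exact: cmeasurable_reflect.
  under [X in cdominated X]eq_fun do rewrite mulrC.
  by apply: cdominatedM => //; exact: cdominated_reflect.
rewrite /convolution -cintegralB; [|exact: ifg|exact: ifg].
by congr cintegral; apply/funext => y; rewrite mulrBl.
Qed.

Lemma convolutionBr (R : realType) n (f g1 g2 : 'rV[R]_n -> R[i]) x :
  cmeasurable f -> cmeasurable g1 -> cmeasurable g2 ->
  cdominated f -> cbounded g1 -> cbounded g2 ->
  convolution f (fun y => g1 y - g2 y) x =
  convolution f g1 x - convolution f g2 x.
Proof.
move=> mf mg1 mg2 df bg1 bg2.
have ifg (g : 'rV[R]_n -> R[i]) : cmeasurable g -> cbounded g ->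
    cintegrable (fun y => f y * g (x - y)).
  move=> mg bg; apply: cdominated_integrable.
    by apply: cmeasurableM => //; exact: cmeasurable_reflect.
  by apply: cdominatedM => //; exact: cbounded_reflect.
rewrite /convolution -cintegralB; [|exact: ifg|exact: ifg].
by congr cintegral; apply/funext => y; rewrite mulrBr.
Qed.

Lemma defect_convolution_bounded (R : realType) (n : nat) (a : R)
    (T : schwartz R n -> schwartz R n) :
  (forall (f g : schwartz R n) (x : 'rV[R]_n),
     `|T (schwartz_mul f g) x - convolution (T f) (T g) x| <= a%:C) ->
  forall f g x, exists C, forall h, l1norm (convolution
    (fun y => T (schwartz_mul f g) y - convolution (T f) (T g) y) (T h) x) <= C.
Proof.
move=> H f g x.
have mS (u : schwartz R n) : cmeasurable u := schwartz_cmeasurable u.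
have dS (u : schwartz R n) : cdominated u := schwartz_cdominated u.
have bS (u : schwartz R n) : cbounded u := cdominated_bounded (dS u).
have mC (u v : schwartz R n) : cmeasurable (convolution u v).
  exact/ccontinuous_measurable/ccontinuous_convolution/bS/dS/schwartz_ccontinuous.
have bC (u v : schwartz R n) : cbounded (convolution u v).
  by apply: cbounded_convolution.
have [M fM] := dS (T f).
(* The first term bounds [E3], where [M] dominates [T f] and the defect of [g] and [h] is at most
   [2 * a] in [l1norm]; the other two bound the defects [E1] and [E2]. None depends on [h]. *)
exists (2 * (M * (2 * a)) * \int[lebesgue_rV R n]_y weight y + 2 * a + 2 * a)%R => h.
have TA : T (schwartz_mul (schwartz_mul f g) h) =
    T (schwartz_mul f (schwartz_mul g h)).
  by congr T; apply: schwartz_inj => y /=; rewrite mulrA.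
rewrite convolutionBl// convolutionA//.
pose E1 := T (schwartz_mul (schwartz_mul f g) h) x -
  convolution (T (schwartz_mul f g)) (T h) x.
pose E2 := T (schwartz_mul f (schwartz_mul g h)) x -
  convolution (T f) (T (schwartz_mul g h)) x.
pose E3 := convolution (T f) (fun y => T (schwartz_mul g h) y -
  convolution (T g) (T h) y) x.
(* By [TA] the leading values of [E1] and [E2] coincide and cancel. The combination is written with
   differences alone, so that [l1normB] applied twice bounds it. *)
have -> : convolution (T (schwartz_mul f g)) (T h) x -
    convolution (T f) (convolution (T g) (T h)) x = E3 - E1 - (- E2).
  rewrite /E3 convolutionBr// /E1 /E2 TA.
  set p := convolution _ _ _; set q := convolution _ _ _.
  set r := convolution _ _ _; set s := T _ x.
  by ring.
have lN (z : R[i]) : l1norm (- z) = l1norm z.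
  by rewrite /l1norm; case: z => u v /=; rewrite !normrN.
apply: le_trans (l1normB _ _) _; rewrite lN lerD//; last first.
  exact: l1norm_le_normc (H _ _ _).
apply: le_trans (l1normB _ _) _; rewrite lerD//; last first.
  exact: l1norm_le_normc (H _ _ _).
apply: l1norm_cintegral => [|y].
  apply: cmeasurableM => //; apply: (@cmeasurable_reflect _ _
    (fun y => T (schwartz_mul g h) y - convolution (T g) (T h) y)).
  exact: cmeasurableB.
rewrite (le_trans (l1normM _ _))// mulrAC ler_pM ?l1norm_ge0//.
exact: l1norm_le_normc (H _ _ _).
Qed.

(** Each integral against a Gaussian is linear in the amplitude [c]; a bound uniform in [c] forces
    it to vanish, and then the Gaussian integrals determine the value at [x]. *)
Lemma gaussian_convolutions_bounded_eq0 (R : realType) n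
    (f : 'rV[R]_n -> R[i]) x :
  ccontinuous f -> cbounded f ->
  (exists C, forall k (k0 : 0 < k) c,
    l1norm (convolution f (gaussian k0 c) x) <= C) ->
  f x = 0.
Proof.
move=> [cR cI] [A fA] [C fC].
have H (q : 'rV[R]_n -> R) : continuous q -> (forall y, `|q y| <= A) ->
    (forall k, 0 < k -> forall c,
      `|(\int[lebesgue_rV R n]_y
          (q y * (c * expR (- k * sqnorm (x - y)))))%R| <= C) ->
    q x = 0.
  move=> cq qA qC; apply: (gaussian_Rintegrals_eq0 cq qA) => k k0.
  set J := (\int[_]_y _)%R; apply/eqP; apply: contraT => J0.
  (* If [J] were nonzero, this amplitude would make the integral equal to [C + 1], above its bound
     [C]. *)
  have := qC k k0 ((C + 1) / J).
  rewrite (_ : (\int[_]_y _)%R = (C + 1) / J * J); last first.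
    have [M HM] := gaussian_dominated x k0.
    rewrite -RintegralZl//; first by apply: eq_Rintegral => y _; rewrite mulrCA.
    apply: (@integrable_dominated _ _ _ (A * M)) => [|y].
      apply: measurable_funM; first exact: continuous_measurable_rV.
      exact: measurable_gaussian_reflect.
    by rewrite normrM -mulrA ler_pM// ger0_norm ?expR_ge0.
  rewrite divfK// => h; have := le_trans (ler_norm _) h.
  by rewrite gerDl ler10.
(* Gaussians are real-valued, so the complex convolution separates into real integrals of [Re f] and
   [Im f], to which [H] applies one at a time. *)
have RI (k : R) (k0 : 0 < k) (c : R) y : f y * gaussian k0 c (x - y) =
    (complex.Re (f y) * (c * expR (- k * sqnorm (x - y)))) +i*
    (complex.Im (f y) * (c * expR (- k * sqnorm (x - y)))).
  case: (f y) => u v /=; apply/eqP.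
  by rewrite eq_complex /= !mulr0 subr0 add0r !eqxx.
apply/eqP; rewrite eq_complex; apply/andP; split; apply/eqP.
  apply: (H (fun y => complex.Re (f y))) => // [y|k k0 c].
    exact: le_trans (Re_le_l1norm _) (fA y).
  apply: le_trans (fC k k0 c); apply: le_trans (Re_le_l1norm _).
  have -> : complex.Re (convolution f (gaussian k0 c) x) =
      (\int[lebesgue_rV R n]_y complex.Re (f y * gaussian k0 c (x - y)))%R by [].
  by under [in leRHS]eq_Rintegral do rewrite RI.
apply: (H (fun y => complex.Im (f y))) => // [y|k k0 c].
  exact: le_trans (Im_le_l1norm _) (fA y).
apply: le_trans (fC k k0 c); apply: le_trans (Im_le_l1norm _).
have -> : complex.Im (convolution f (gaussian k0 c) x) =
    (\int[lebesgue_rV R n]_y complex.Im (f y * gaussian k0 c (x - y)))%R by [].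
by under [in leRHS]eq_Rintegral do rewrite RI.
Qed.

Theorem proposition3 (R : realType) (n : nat) (a : R)
    (T : schwartz R n -> schwartz R n) :
  0 < a ->
  bijective T ->
  (forall (f g : schwartz R n) (x : 'rV[R]_n),
     `|T (schwartz_mul f g) x - convolution (T f) (T g) x| <= a%:C) ->
  forall f g : schwartz R n,
    T (schwartz_mul f g) = convolution (T f) (T g) :> ('rV[R]_n -> R[i]).
Proof.
move=> _ [T' _ T'K] H f g; apply/funext => x.
apply/eqP; rewrite -subr_eq0; apply/eqP.
have cT := schwartz_ccontinuous (T (schwartz_mul f g)).
have cC : ccontinuous (convolution (T f) (T g)).
  apply: ccontinuous_convolution.
  - exact: schwartz_cmeasurable.
  - exact: schwartz_ccontinuous.
  - exact: schwartz_cdominated.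
  - exact/cdominated_bounded/schwartz_cdominated.
pose D y := T (schwartz_mul f g) y - convolution (T f) (T g) y.
apply: (@gaussian_convolutions_bounded_eq0 _ _ D).
- split=> y.
    rewrite (_ : (fun z => _) = (fun z => 1 * complex.Re (T (schwartz_mul f g) z)
      + (-1) * complex.Re (convolution (T f) (T g) z))).
      exact: (continuous_linear_combination cT.1 cC.1).
    by apply/funext => z; rewrite ReB mul1r mulN1r.
  rewrite (_ : (fun z => _) = (fun z => 1 * complex.Im (T (schwartz_mul f g) z)
    + (-1) * complex.Im (convolution (T f) (T g) z))).
    exact: (continuous_linear_combination cT.2 cC.2).
  by apply/funext => z; rewrite ImB mul1r mulN1r.
- by exists (2 * a) => y; exact: l1norm_le_normc (H _ _ _).
- have [C hC] := defect_convolution_bounded H f g x.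
  (* The Gaussian is the image under [T] of its preimage by [T'], so the bound valid for all [h]
     applies with one [C] for every rate and amplitude. *)
  by exists C => k k0 c; rewrite -(T'K (gaussian k0 c)); exact: hC.
Qed.
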